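(* Let $\Phi:\mathbb{R}\times\Omega\times S^1\times S^1\times\mathbb{R}^d\to S^1\times S^1\times\mathbb{R}^d$ be a $C^1$ perfect cocycle over the metric dynamical system $(\Omega,\mathcal{F},P,(\theta_t)_{t\in\mathbb{R}})$ which is generated by a system of the form $$\Phi(t,\omega)(x_0,y_0,z_0)=\bigl(f(t;(x_0,y_0)),\,g(t,\omega,z_0)\bigr),\qquad (x_0,y_0)\in S^1\times S^1,\ z_0\in\mathbb{R}^d,$$ where $f(t;\cdot)$ takes values in $S^1\times S^1$ and does not depend on $\omega$, and $g$ takes values in $\mathbb{R}^d$. Assume that there exist two rationally independent numbers $t_1,t_2$ such that for every $\omega\in\Omega$ and every $(x,y,z)\in S^1\times S^1\times\mathbb{R}^d$, $$\Phi(t_1,\omega)(x,y,z)=(x,y',z')\quad\text{and}\quad \Phi(t_2,\omega)(x,y,z)=(x'',y,z'')$$ for some $y',x''\in S^1$ and $z',z''\in\mathbb{R}^d$. Assume moreover that for every $\varepsilon>0$ there is a relatively dense set of numbers $\{\tau_k\}\subset\mathbb{R}$ such that, for all $k$, $$d\bigl(f(\tau_k;(x,y)) \bmod \mathbb{Z}\times\mathbb{Z},\,(x,y)\bigr)<\tfrac{1}{\sqrt2}\varepsilon\quad\text{for all }(x,y)\in S^1\times S^1,$$ and, for almost all $\omega\in\Omega$, $$d\bigl(g(t+\tau_k,\omega,z),\,g(t,\theta_{\tau_k}\omega,z)\bigr)<\tfrac{1}{\sqrt2}\varepsilon\quad\text{for all }z\in\mathbb{R}^d,\ t\in\mathbb{R},\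 k.$$ Then $\Phi$ has a random almost periodic solution.
   Context: $(\Omega,\mathcal{F},P)$ is a probability space and $(\theta_t)_{t\in\mathbb{R}}$ is a measure-preserving measurable flow on it: $\theta_0=\mathrm{Id}$, $\theta_{t+s}=\theta_t\circ\theta_s$, $(\omega,t)\mapsto\theta_t\omega$ is measurable, and each $\theta_t$ preserves $P$. Together these form a metric dynamical system. $S^1=\mathbb{R}/\mathbb{Z}$, and $d$ denotes the natural distance on $S^1\times S^1$ and on $\mathbb{R}^d$; on $S^1\times S^1\times\mathbb{R}^d$ the distance is $d((p,z),(q,w))=\sqrt{d^2(p,q)+d^2(z,w)}$ for $p,q\in S^1\times S^1$, $z,w\in\mathbb{R}^d$. Write $M=S^1\times S^1\times\mathbb{R}^d$. A $C^1$ perfect cocycle is a $(\mathcal{B}(\mathbb{R})\otimes\mathcal{F}\otimes\mathcal{B}(M),\mathcal{B}(M))$-measurable map $\Phi:\mathbb{R}\times\Omega\times M\to M$ such that: (i) for each $\omega$, $\Phi(0,\omega)=\mathrm{Id}$; (ii) for each $\omega$, $\Phi(t_1+t_2,\omega)x=\Phi(t_2,\theta_{t_1}\omega)\Phi(t_1,\omega)x$ for all $x\in M$, $t_1,t_2\in\mathbb{R}$; (iii) for each $\omega$, the map $(t,x)\mapsto\Phi(t,\omega)x$ is continuous; (iv) for each $(t,\omega)$, $\Phi(t,\omega):M\to M$ is a $C^1$ diffeomorphism. A set $E\subset\mathbb{R}$ is relatively dense if there is $l>0$ such that every interval $[a,a+l]$, $a\in\mathbb{R}$, contains at least one point of $E$.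 A random almost periodic solution of $\Phi$ is an $\mathcal{F}$-measurable map $H:\mathbb{R}\times\Omega\to M$ (i.e. $\omega\mapsto H(t,\omega)$ is $\mathcal{F}$-measurable for each $t$) such that for any $\varepsilon>0$ there is a number $l(\varepsilon)$ defining a relatively dense set of numbers $\{\tau_k\}$ (every interval of length $l(\varepsilon)$ contains some $\tau_k$) such that for almost all $\omega\in\Omega$, $$\Phi(t,\theta_s\omega)H(s,\omega)=H(t+s,\omega),\qquad d(H(s+\tau_k,\omega),H(s,\theta_{\tau_k}\omega))<\varepsilon,\qquad\forall t,s\in\mathbb{R},\ \forall k.$$ *)

(* Defs.v *)
From HB Require Import structures.
From mathcomp Require Import all_boot all_order all_algebra.
From mathcomp Require Import all_classical all_reals all_analysis.
From mathcomp Require Export generic_quotient ring_quotient.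

Set Implicit Arguments.
Unset Strict Implicit.
Unset Printing Implicit Defensive.

Import Order.TTheory GRing.Theory Num.Theory.
Import numFieldNormedType.Exports.

Local Open Scope classical_set_scope.
Local Open Scope ring_scope.
Local Open Scope quotient_scope.

(* The subgroup Z of R; int_num_subdef is the predicate underlying Num.int. *)
Definition integers (R : realType) : zmodClosed R :=
  GRing.ZmodClosed.clone R (@Num.int_num_subdef R) _.

(* R / Z, as the quotient of the additive group R by the subgroup Z,
   with the quotient topology. *)
Definition circle (R : realType) : Type :=
  quotient_topology (Quotient.quot (integers R)).
HB.instance Definition _ (R : realType) := Quotient.on (circle R).
HB.instance Definition _ (R : realType) := PointedTopological.on (circle R).

Definition torus (R : realType) : Type := (circle R * circle R)%type.
HB.instance Definition _ (R : realType) :=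
  Topological.copy (torus R) (circle R * circle R)%type.
HB.instance Definition _ (R : realType) :=
  Pointed.copy (torus R) (circle R * circle R)%type.

Definition phase (R : realType) (n : nat) : Type := (torus R * 'rV[R]_n)%type.
HB.instance Definition _ (R : realType) (n : nat) :=
  Topological.copy (phase R n) (torus R * 'rV[R]_n)%type.
HB.instance Definition _ (R : realType) (n : nat) :=
  Pointed.copy (phase R n) (torus R * 'rV[R]_n)%type.

(* Quotient metric of R / Z : the least distance between representatives. *)
Definition circle_dist (R : realType) (p q : circle R) : R :=
  inf [set r | exists x y : R,
    [/\ \pi_(circle R) x = p, \pi_(circle R) y = q & r = `|x - y|]].

Definition torus_dist (R : realType) (p q : torus R) : R :=
  Num.sqrt (circle_dist p.1 q.1 ^+ 2 + circle_dist p.2 q.2 ^+ 2).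

(* The Euclidean distance; the library norm on 'rV[R]_n is the sup norm. *)
Definition euclid_dist (R : realType) (n : nat) (z w : 'rV[R]_n) : R :=
  Num.sqrt (\sum_(i < n) (z ord0 i - w ord0 i) ^+ 2).

Definition phase_dist (R : realType) (n : nat) (x y : phase R n) : R :=
  Num.sqrt (torus_dist x.1 y.1 ^+ 2 + euclid_dist x.2 y.2 ^+ 2).

Definition borel_phase (R : realType) (n : nat) : Type :=
  g_sigma_algebraType (@open (phase R n)).
HB.instance Definition _ (R : realType) (n : nat) :=
  Measurable.on (borel_phase R n).

(* The universal covering space R x R x R^n of the phase space. *)
Definition cover (R : realType) (n : nat) : normedModType R :=
  (R^o * R^o * 'rV[R]_n)%type.

Definition proj (R : realType) (n : nat) (v : cover R n) : phase R n :=
  ((\pi_(circle R) v.1.1, \pi_(circle R) v.1.2), v.2).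

(* In finite dimension, continuity of the differential in the operator norm is
   continuity of each directional derivative. *)
Definition C1_at (R : realType) (V W : normedModType R) (G : V -> W) (v : V) :=
  (\forall w \near v, differentiable G w) /\
  (forall h : V, {for v, continuous (fun w => 'd G w h)}).

(* The charts of the phase space are the local inverses of proj, so a map is C^1
   iff near every point of the cover it is represented by a C^1 map upstairs. *)
Definition C1_map (R : realType) (n : nat) (F : phase R n -> phase R n) :=
  forall v : cover R n, exists G : cover R n -> cover R n,
    (\forall w \near v, C1_at G w) /\
    (\forall w \near v, proj (G w) = F (proj w)).

Definition C1_diffeo (R : realType) (n : nat) (F : phase R n -> phase R n) :=
  C1_map F /\
  exists Finv : phase R n -> phase R n,
    [/\ cancel F Finv, cancel Finv F & C1_map Finv].

Record metric_dynamical_system (R : realType) (d : measure_display)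
    (Omega : measurableType d) (P : probability Omega R)
    (theta : R -> Omega -> Omega) : Prop := {
  mds0 : theta 0 = id ;
  mdsD : forall t s, theta (t + s) = theta t \o theta s ;
  mds_measurable : measurable_fun setT
    (fun q : Omega * measurableTypeR R => theta q.2 q.1) ;
  mds_preserving : forall (t : R) (A : set Omega),
    measurable A -> P (theta t @^-1` A) = P A }.

Record C1_perfect_cocycle (R : realType) (d : measure_display)
    (Omega : measurableType d) (theta : R -> Omega -> Omega) (n : nat)
    (Phi : R -> Omega -> phase R n -> phase R n) : Prop := {
  cocycle_measurable : measurable_fun setT
    (fun q : measurableTypeR R * Omega * borel_phase R n =>
       Phi q.1.1 q.1.2 q.2 : borel_phase R n) ;
  cocycle0 : forall omega, Phi 0 omega = id ;
  cocycleD : forall omega (x : phase R n) (t1 t2 : R),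
    Phi (t1 + t2) omega x = Phi t2 (theta t1 omega) (Phi t1 omega x) ;
  cocycle_continuous : forall omega,
    continuous (fun q : R * phase R n => Phi q.1 omega q.2) ;
  cocycle_C1 : forall (t : R) omega, C1_diffeo (Phi t omega) }.

Definition relatively_dense (R : realType) (E : set R) : Prop :=
  exists2 l : R, 0 < l &
    forall a : R, exists2 tau, E tau & a <= tau <= a + l.

Definition rationally_independent (R : realType) (t1 t2 : R) : Prop :=
  forall q1 q2 : rat, ratr q1 * t1 + ratr q2 * t2 = 0 -> q1 = 0 /\ q2 = 0.

Definition random_almost_periodic_solution (R : realType) (d : measure_display)
    (Omega : measurableType d) (P : probability Omega R)
    (theta : R -> Omega -> Omega) (n : nat)
    (Phi : R -> Omega -> phase R n -> phase R n)
    (H : R -> Omega -> phase R n) : Prop :=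
  (forall t : R, measurable_fun setT (H t : Omega -> borel_phase R n)) /\
  forall eps : R, 0 < eps ->
    exists2 E : set R, relatively_dense E &
      {ae P, forall omega,
        (forall t s : R, Phi t (theta s omega) (H s omega) = H (t + s) omega) /\
        (forall s tau : R, E tau ->
           phase_dist (H (s + tau) omega) (H s (theta tau omega)) < eps)}.

(* Main.v *)
Require Import Defs.
From HB Require Import structures.
From mathcomp Require Import all_boot all_order all_algebra.
From mathcomp Require Import all_classical all_reals all_analysis.

Import Order.TTheory GRing.Theory Num.Theory.
Import numFieldNormedType.Exports.

Local Open Scope classical_set_scope.
Local Open Scope ring_scope.

(** Every orbit is a random almost periodic solution: fix an initial point
    (p, z) of the phase space and put H t omega = Phi t omega (p, z).

    - The invariance of H is the cocycle property, for every omega.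
    - In the fibre R^n, the quantity to be estimated is exactly the one bounded
      by the hypothesis on the almost periods, at the initial value z.
    - On the torus, the cocycle property makes f a flow, because f does not see
      omega.  Hence f (s + tau) p = f tau (f s p), and the smallness of the
      displacement of f tau, being uniform on the torus, applies at the moved
      point f s p: it is uniform in s.

    The two coordinates are each within eps / sqrt 2, so the distance in the
    product is less than eps by Pythagoras.  The almost periods of Phi thus
    serve unchanged for H, with the same null set. *)

Lemma hypotenuse_lt (R : realType) (a b e : R) : 0 <= a -> 0 <= b ->
  a < e / Num.sqrt 2 -> b < e / Num.sqrt 2 -> Num.sqrt (a ^+ 2 + b ^+ 2) < e.
Proof.
move=> a0 b0 ae be.
have r0 : 0 < Num.sqrt 2 :> R by rewrite sqrtr_gt0.
have e0 : 0 < e by have := le_lt_trans a0 ae; rewrite pmulr_lgt0 ?invr_gt0.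
have leg x : 0 <= x -> x < e / Num.sqrt 2 -> x ^+ 2 < e ^+ 2 / 2.
  move=> x0 xe; rewrite -[ltRHS](_ : (e / Num.sqrt 2) ^+ 2 = _).
    by rewrite ltr_pXn2r // nnegrE ?(ltW (le_lt_trans x0 xe)).
  by rewrite expr_div_n sqr_sqrtr.
rewrite -[ltRHS](ger0_norm (ltW e0)) -sqrtr_sqr ltr_sqrt ?exprn_gt0 //.
by rewrite [ltRHS]splitr ltrD ?leg.
Qed.

Lemma measurable_orbit (R : realType) (d : measure_display)
    (Omega : measurableType d) (theta : R -> Omega -> Omega) (n : nat)
    (Phi : R -> Omega -> phase R n -> phase R n) (t : R) (x : phase R n) :
  C1_perfect_cocycle theta Phi ->
  measurable_fun setT ((fun omega => Phi t omega x) : Omega -> borel_phase R n).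
Proof.
move=> cocycle.
apply: (measurableT_comp (cocycle_measurable cocycle)
  (g := fun omega => (t : measurableTypeR R, omega, x : borel_phase R n))).
by do 2?apply: measurable_fun_pair.
Qed.

(** Evaluating the cocycle at a single omega suffices, since the base component
    of Phi is the same for all of them. *)
Lemma base_flow {R : realType} {d : measure_display}
    {Omega : measurableType d} {theta : R -> Omega -> Omega} {n : nat}
    {Phi : R -> Omega -> phase R n -> phase R n}
    {f : R -> torus R -> torus R} {g : R -> Omega -> 'rV[R]_n -> 'rV[R]_n}
    (omega : Omega) :
  C1_perfect_cocycle theta Phi ->
  (forall t omega p z, Phi t omega (p, z) = (f t p, g t omega z)) ->
  forall s t p, f (s + t) p = f t (f s p).
Proof.
move=> cocycle PhiE s t p.
by have := cocycleD cocycle omega (p, 0) s t; rewrite !PhiE => -[].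
Qed.

Theorem theorem4p3 (R : realType) (d : measure_display)
    (Omega : measurableType d) (P : probability Omega R)
    (theta : R -> Omega -> Omega) (n : nat)
    (Phi : R -> Omega -> phase R n -> phase R n)
    (f : R -> torus R -> torus R)
    (g : R -> Omega -> 'rV[R]_n -> 'rV[R]_n)
    (mds : metric_dynamical_system P theta)
    (cocycle : C1_perfect_cocycle theta Phi)
    (PhiE : forall (t : R) (omega : Omega) (p : torus R) (z : 'rV[R]_n),
      Phi t omega (p, z) = (f t p, g t omega z))
    (t1 t2 : R)
    (indep : rationally_independent t1 t2)
    (Phi_t1 : forall (omega : Omega) (x y : circle R) (z : 'rV[R]_n),
      exists (y' : circle R) (z' : 'rV[R]_n),
        Phi t1 omega ((x, y), z) = ((x, y'), z'))
    (Phi_t2 : forall (omega : Omega) (x y : circle R) (z : 'rV[R]_n),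
      exists (x'' : circle R) (z'' : 'rV[R]_n),
        Phi t2 omega ((x, y), z) = ((x'', y), z''))
    (almost_periods : forall eps : R, 0 < eps ->
      exists E : set R,
        [/\ relatively_dense E,
            (forall (tau : R) (p : torus R), E tau ->
               torus_dist (f tau p) p < eps / Num.sqrt 2) &
            {ae P, forall omega, forall (z : 'rV[R]_n) (t tau : R), E tau ->
               euclid_dist (g (t + tau) omega z) (g t (theta tau omega) z)
                 < eps / Num.sqrt 2}]) :
  exists H : R -> Omega -> phase R n,
    random_almost_periodic_solution P theta Phi H.
Proof.
pose x0 : phase R n := point.
exists (fun t omega => Phi t omega x0); split=> [t|eps eps0].
  exact: measurable_orbit cocycle.
have [E [E_dense fE gE]] := almost_periods eps eps0.
exists E => //; apply: filterS gE => omega gE; split=> [t s|s tau Etau].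
  by rewrite (addrC t s) (cocycleD cocycle).
rewrite (surjective_pairing x0) !PhiE.
apply: hypotenuse_lt; rewrite ?sqrtr_ge0 //=; last exact: gE.
by rewrite (base_flow omega cocycle PhiE) fE.
Qed.
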